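(* The additive group of rational numbers $\mathbb{Q}$ cannot be embedded into a finitely generated nilpotent group; that is, there is no injective homomorphism from $\mathbb{Q}$ to any finitely generated nilpotent group. *)

(* Defs.v *)
From mathcomp Require Import all_boot all_order all_algebra.
From mathcomp Require Import classical_sets cardinality.

Set Implicit Arguments.
Unset Strict Implicit.
Unset Printing Implicit Defensive.

Local Open Scope classical_set_scope.
Local Open Scope group_scope.

Definition is_subgroup (G : groupType) (H : set G) : Prop :=
  H 1 /\ (forall x y : G, H x -> H y -> H (x / y)).

Definition subgroup_generated (G : groupType) (A : set G) : set G :=
  smallest (@is_subgroup G) A.

Definition finitely_generated (G : groupType) : Prop :=
  exists2 A : set G, finite_set A & subgroup_generated A = [set: G].

Definition commutator_subgroup (G : groupType) (A B : set G) : set G :=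
  subgroup_generated [set [~ x, y] | x in A & y in B].

(* Indexed from 0: the zeroth term is the whole group, so that the group has
   nilpotency class at most n iff the term of index n is trivial. *)
Definition lower_central (G : groupType) (n : nat) : set G :=
  iter n (fun H : set G => commutator_subgroup H [set: G]) [set: G].

Arguments lower_central : clear implicits.

Definition nilpotent (G : groupType) : Prop :=
  exists n : nat, lower_central G n = [set 1].

(* Main.v *)
Require Import Defs.
From mathcomp Require Import all_boot all_order all_algebra.
From mathcomp Require Import classical_sets cardinality.

(** Write gamma_i for the lower central series. Modulo gamma_(i+1), the
    commutator is a bimorphism on gamma_i x G, so each gamma_i is generated by
    gamma_(i+1) together with finitely many elements. Adjoining these one at a
    time refines the lower central series to a finite chain of normal subgroups
    of G with cyclic successive quotients. A cyclic group contains no nontrivial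
    divisible subgroup, so the image of the rationals descends along this chain
    down to the trivial group. *)

Set Implicit Arguments.
Unset Strict Implicit.
Unset Printing Implicit Defensive.

Section DivisibleSubsets.
Local Open Scope classical_set_scope.
Local Open Scope group_scope.

(** * Subgroups and congruences *)

Definition is_normal (G : groupType) (N : set G) : Prop :=
  is_subgroup N /\ forall x y : G, N x -> N (x ^ y).

(** Roots are required in [D] itself, so that any subgroup known to contain [D] also contains
    them. *)
Definition divisible (G : groupType) (D : set G) : Prop :=
  forall (x : G) (n : nat), D x -> 0 < n -> exists2 y, D y & x = y ^+ n.

Lemma subgroup1 (G : groupType) (H : set G) : is_subgroup H -> H 1.
Proof. by case. Qed.

Lemma subgroupV (G : groupType) (H : set G) x : is_subgroup H -> H x -> H x^-1.
Proof. by case=> H1 HF Hx; rewrite -div1g; apply: HF. Qed.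

Lemma subgroupM (G : groupType) (H : set G) x y :
  is_subgroup H -> H x -> H y -> H (x * y).
Proof.
move=> Hs Hx Hy; rewrite -[y]invgK; apply: Hs.2 => //; exact: subgroupV.
Qed.

Lemma subgroupX (G : groupType) (H : set G) x n :
  is_subgroup H -> H x -> H (x ^+ n).
Proof.
move=> Hs Hx; elim: n => [|n IHn]; first exact: subgroup1.
by rewrite expgS; apply: subgroupM.
Qed.

Lemma is_subgroup_generated (G : groupType) (A : set G) :
  is_subgroup (subgroup_generated A).
Proof.
split=> [H [[H1 _] _] //|x y Ax Ay H [Hs AH]].
by apply: Hs.2; [apply: Ax | apply: Ay].
Qed.

Lemma is_subgroup_setT (G : groupType) : is_subgroup [set: G].
Proof. by []. Qed.

Lemma normal_of_commg (G : groupType) (N : set G) :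
  is_subgroup N -> (forall x y, N x -> N [~ x, y]) -> is_normal N.
Proof.
move=> Ns NR; split=> // x y Nx.
rewrite -[x ^ y](mulVKg x) -commgEl; apply: subgroupM => //; exact: NR.
Qed.

(** [N (x / u)] encodes equality of [x] and [u] in the quotient by [N], which is never formed. *)
Lemma congM (G : groupType) (N : set G) x y u v : is_normal N ->
  N (x / u) -> N (y / v) -> N (x * y / (u * v)).
Proof.
case=> Ns NJ Nxu Nyv.
have -> : x * y / (u * v) = (y / v) ^ x^-1 * (x / u).
  by rewrite conjgE invgK invgM !mulgA mulgVK.
by apply: subgroupM => //; apply: NJ.
Qed.

Lemma congV (G : groupType) (N : set G) x u : is_normal N ->
  N (x / u) -> N (x^-1 / u^-1).
Proof.
case=> Ns NJ Nxu.
have -> : x^-1 / u^-1 = ((x / u) ^ x)^-1.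
  by rewrite conjgE -mulgA mulKg invgM.
by apply: subgroupV => //; apply: NJ.
Qed.

Lemma congX (G : groupType) (N : set G) x u n : is_normal N ->
  N (x / u) -> N (x ^+ n / u ^+ n).
Proof.
move=> Nn Nxu; elim: n => [|n IHn]; last by rewrite !expgS; apply: congM.
by rewrite !expg0 mulgV; apply: subgroup1 Nn.1.
Qed.

Lemma cong_trans (G : groupType) (N : set G) x y z : is_subgroup N ->
  N (x / y) -> N (y / z) -> N (x / z).
Proof.
by move=> Ns Nxy Nyz; rewrite -(divgKA y x z^-1); apply: subgroupM.
Qed.

Lemma cong_sym (G : groupType) (N : set G) x y : is_subgroup N ->
  N (x / y) -> N (y / x).
Proof. by move=> Ns Nxy; rewrite -invgF; apply: subgroupV. Qed.

(** * Divisible subsets of cyclic extensions *)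

Lemma expgn_divD (G : groupType) (c : G) p q r s :
  c ^+ (p + s) / c ^+ (r + q) = c ^+ p / c ^+ q / (c ^+ r / c ^+ s).
Proof.
rewrite !expgnDr !invgM invgK -!mulgA; congr (_ * _); rewrite !mulgA.
congr (_ / _); apply/esym/commute_sym/commuteV.
exact/commuteX2/commute_refl.
Qed.

(* The integer exponent of [c] is encoded as a difference of naturals. *)
Lemma adjoin_cyclic (G : groupType) (N : set G) (c : G) : is_normal N ->
  subgroup_generated (N `|` [set c]) `<=`
    [set x | exists p q, N (x / (c ^+ p / c ^+ q))].
Proof.
move=> Nn; have Ns := Nn.1; apply: smallest_sub; last first.
  move=> x [Nx|->]; first by exists 0%N, 0%N; rewrite expg0 !divg1.
  by exists 1%N, 0%N; rewrite expg0 expg1 divg1 mulgV; apply: subgroup1.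
split=> [|x y [p [q Nx]] [r [s Ny]]].
  by exists 0%N, 0%N; rewrite expg0 !divg1; apply: subgroup1.
exists (p + s)%N, (r + q)%N.
by rewrite expgn_divD; apply: congM => //; apply: congV.
Qed.

Lemma cong_expg (G : groupType) (N : set G) (c : G) p q : is_normal N ->
  p != q -> N (c ^+ p / c ^+ q) -> exists2 m, 0 < m & N (c ^+ m).
Proof.
move=> Nn; have Ns := Nn.1; wlog lepq : p q / q <= p => [WH ne_pq Npq|].
  case: (leqP q p) => [le_qp|/ltnW le_pq]; first exact: WH Npq.
  by apply: (WH q p) => //; [rewrite eq_sym | apply: cong_sym].
move=> ne_pq Npq; exists (p - q)%N; last by rewrite expgnFr.
by rewrite subn_gt0 ltn_neqAle eq_sym ne_pq.
Qed.

(** Modulo [N], elements of [D] are powers of [c]. If [c ^+ m] is in [N] with [m > 0], then all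
    [m]-th powers of such elements vanish, and every element of [D] is one. Otherwise the exponent
    of an element of [D] is divisible by every positive integer, hence zero. *)
Lemma divisible_sub_cyclic (G : groupType) (N D : set G) (c : G) :
  is_normal N -> divisible D ->
  D `<=` subgroup_generated (N `|` [set c]) -> D `<=` N.
Proof.
move=> Nn Ddiv DNc x Dx; have Ns := Nn.1.
have coset y : D y -> exists p q, N (y / (c ^+ p / c ^+ q)).
  by move=> /DNc; apply: adjoin_cyclic.
have cX p q n : (c ^+ p / c ^+ q) ^+ n = c ^+ (p * n) / c ^+ (q * n).
  rewrite !expgnA; apply: expgnFl; exact/commuteX2/commute_refl.
have torsion m : 0 < m -> N (c ^+ m) -> N x.
  move=> m_gt0 Nm; have [y /coset[p [q Ny]] ->] := Ddiv x m Dx m_gt0.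
  rewrite -[y ^+ m]divg1; apply: (cong_trans Ns (congX m Nn Ny)).
  rewrite divg1 cX !(mulnC _ m) !expgnA.
  by apply: Ns.2; apply: subgroupX.
have [p [q Nx]] := coset x Dx.
(* If c has infinite order modulo N, then n = p + q + 1 divides p - q, so p = q. *)
have [y /coset[r [s Ny]] def_x] := Ddiv x (p + q).+1 Dx isT.
set n := (p + q).+1 in def_x.
(* [x] has exponent [p - q] and, being [y ^+ n], also [(r - s) * n]; the comparison is cleared of
   subtractions. *)
have Nrs : N (c ^+ (p + s * n) / c ^+ (r * n + q)).
  rewrite expgn_divD -cX; apply: (cong_trans Ns (cong_sym Ns Nx)).
  by rewrite def_x; apply: congX.
have [eq_e|ne_e] := eqVneq (p + s * n)%N (r * n + q)%N; last first.
  by have [m] := cong_expg Nn ne_e Nrs; apply: torsion.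
suff eq_pq : p = q by move: Nx; rewrite eq_pq mulgV divg1.
(* Both [p] and [q] are below [n], so reduction modulo [n] recovers them. *)
have /(congr1 (modn^~ n)) := eq_e.
by rewrite addnC !modnMDl !modn_small // ltnS ?leq_addl ?leq_addr.
Qed.

(** The generators in [s] are discarded one at a time. Each intermediate subgroup [K] lies between
    [L] and [H], so commutators of [K] with the whole group fall in [L], hence in [K], and [K] is
    normal. *)
Lemma divisible_sub_central (G : groupType) (H L D : set G) (s : seq G) :
  is_subgroup H -> is_subgroup L -> L `<=` H ->
  (forall x y, H x -> L [~ x, y]) -> [set` s] `<=` H -> divisible D ->
  D `<=` subgroup_generated (L `|` [set` s]) -> D `<=` L.
Proof.
move=> Hs Ls LH HGL sH Ddiv; elim: s sH => [|c s IHs] sH Dgen.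
  by apply: subset_trans Dgen _; apply: smallest_sub => // x [].
have sH' : [set` s] `<=` H.
  by move=> x /= xs; apply: sH => /=; rewrite inE xs orbT.
apply: IHs => //; set K := subgroup_generated _.
have Ks : is_subgroup K by apply: is_subgroup_generated.
have KH : K `<=` H by apply: smallest_sub => // x [/LH|/sH'].
have LK : L `<=` K by move=> x Lx; apply: sub_gen_smallest; left.
apply: (@divisible_sub_cyclic _ _ _ c) => //.
  by apply: normal_of_commg => // x y Kx; exact: LK (HGL _ _ (KH _ Kx)).
apply: subset_trans Dgen _; apply: smallest_sub.
  exact: is_subgroup_generated.
move=> x [Lx|/=]; first by apply: sub_gen_smallest; left; exact: LK Lx.
rewrite inE => /orP[/eqP->|xs]; apply: sub_gen_smallest; first by right.
by left; apply: sub_gen_smallest; right.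
Qed.

(** * Finite generation along the lower central series *)

Lemma lower_central_subgroup (G : groupType) n :
  is_subgroup (lower_central G n).
Proof.
by case: n => [|n]; [apply: is_subgroup_setT | apply: is_subgroup_generated].
Qed.

Lemma lower_central_commg (G : groupType) n (x y : G) :
  lower_central G n x -> lower_central G n.+1 [~ x, y].
Proof. by move=> Gx; apply: sub_gen_smallest; exists x => //; exists y. Qed.

Lemma lower_centralS (G : groupType) n :
  lower_central G n.+1 `<=` lower_central G n.
Proof.
elim: n => [//|n IHn]; apply: smallest_sub.
  exact: lower_central_subgroup.
by move=> _ [x Gx [y _ <-]]; exact: lower_central_commg (IHn _ Gx).
Qed.

(** This set is the preimage of the centralizer of [x] modulo [N]; being a subgroup, it need only be
    checked on generators. *)
Lemma commg_centralizer_subgroup (G : groupType) (N : set G) (x : G) :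
  is_normal N -> is_subgroup [set y | N [~ x, y]].
Proof.
move=> Nn; have [Ns NJ] := Nn.
split=> /= [|y z Ny Nz]; first by rewrite commg1; apply: subgroup1.
have -> : [~ x, y / z] = ([~ x, z]^-1 * [~ x, y]) ^ z^-1.
  by rewrite !commgEl !conjgE; rewrite !gnorm.
by apply: NJ; apply: subgroupM => //; apply: subgroupV.
Qed.

(** Likewise for the preimage of the center of the quotient by [N]. *)
Lemma commg_center_subgroup (G : groupType) (N : set G) :
  is_normal N -> is_subgroup [set x | forall y, N [~ x, y]].
Proof.
move=> Nn; have [Ns NJ] := Nn.
split=> /= [y|x z Nx Nz y]; first by rewrite comm1g; apply: subgroup1.
have -> : [~ x / z, y] = ([~ x, y] / [~ z, y]) ^ z^-1.
  by rewrite !commgEl !conjgE; rewrite !gnorm.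
by apply: NJ; apply: Ns.2.
Qed.

(** Inductively, the new generators [t] are the commutators of [s] with the generators [a] of the
    group. Modulo [M], elements of [s] commute with [a], hence with everything, and so do those of
    term [n.+1]; thus term [n] is central modulo [M], and its commutators, which generate term
    [n.+1], lie in [M]. *)
Lemma lower_central_fg (G : groupType) n : finitely_generated G ->
  exists2 s : seq G, [set` s] `<=` lower_central G n &
    lower_central G n `<=`
      subgroup_generated (lower_central G n.+1 `|` [set` s]).
Proof.
move=> [A /finite_seqP[a ->{A}] genA].
elim: n => [|n [s sG Gs]].
  exists a => // x _; have : subgroup_generated [set` a] x by rewrite genA.
  by apply: sub_smallest2r; [apply: is_subgroup_generated | move=> y; right].
pose t := [seq [~ x, y] | x <- s, y <- a].
have tG : [set` t] `<=` lower_central G n.+1.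
  by move=> _ /allpairsP[[x y] [/= /sG Gx _ ->]]; apply: lower_central_commg.
exists t => //; set M := subgroup_generated _.
have Ms : is_subgroup M by apply: is_subgroup_generated.
have MG : M `<=` lower_central G n.+1.
  apply: smallest_sub; first exact: lower_central_subgroup.
  by move=> x [/lower_centralS|/tG].
have GM : lower_central G n.+2 `<=` M.
  by move=> x Gx; apply: sub_gen_smallest; left.
have Mn : is_normal M.
  by apply: normal_of_commg => // x y /MG Gx; exact: GM (lower_central_commg _ Gx).
have sM x y : x \in s -> M [~ x, y].
  move=> xs; have : subgroup_generated [set` a] y by rewrite genA.
  move: y; apply: smallest_sub (commg_centralizer_subgroup x Mn) _ => y /= ya.
  by apply: sub_gen_smallest; right; apply/allpairsP; exists (x, y).
have {}Gs : lower_central G n `<=` [set x | forall y, M [~ x, y]].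
  apply: subset_trans Gs _; apply: smallest_sub.
    exact: commg_center_subgroup.
  by move=> x [Gx|xs] y; [exact: GM (lower_central_commg _ Gx) | exact: sM].
by apply: smallest_sub => // _ [x /Gs Mx [y _ <-]].
Qed.

(** * Nilpotent groups and the rationals *)

Lemma divisible_sub_nilpotent (G : groupType) (D : set G) :
  finitely_generated G -> nilpotent G -> divisible D -> D `<=` [set 1].
Proof.
(* Writing the trivial group as [lower_central G n] lets the induction show that [D] lies in every
   term. *)
move=> Gfg [n <-] Ddiv; elim: n => [//|n IHn].
have [s sG Gs] := lower_central_fg n Gfg.
apply: (divisible_sub_central (lower_central_subgroup G n) _ _ _ sG) => //.
- exact: lower_central_subgroup.
- exact: lower_centralS.
- exact: lower_central_commg.
- exact: subset_trans Gs.
Qed.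

Lemma morph_rat_divisible (G : groupType) (phi : rat -> G) :
  {morph phi : x y / (x + y)%R >-> x * y} -> divisible (range phi).
Proof.
move=> phiD _ n [q _ <-] n_gt0.
have phi0 : phi 0%R = 1 by apply: (mulgI (phi 0%R)); rewrite -phiD GRing.addr0 mulg1.
have phiMn m (r : rat) : phi (r *+ m)%R = phi r ^+ m.
  elim: m => [|m IHm]; first by rewrite GRing.mulr0n.
  by rewrite GRing.mulrS phiD IHm expgS.
exists (phi (q / n%:R)%R); first by exists (q / n%:R)%R.
rewrite -phiMn -(GRing.mulr_natr (_ / _)%R) GRing.divfK //.
by rewrite Num.Theory.pnatr_eq0 -lt0n.
Qed.

End DivisibleSubsets.

Theorem proposition1 (G : groupType)
    (G_fg : finitely_generated G) (G_nil : nilpotent G) :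
  ~ exists phi : rat -> G,
      {morph phi : x y / (x + y)%R >-> (x * y)%g} /\ injective phi.
Proof.
move=> [phi [phiD phi_inj]].
have trivial := divisible_sub_nilpotent G_fg G_nil (morph_rat_divisible phiD).
have phi1 (q : rat) : phi q = 1%g by apply: trivial; exists q.
(* A trivial image forces 0 = 1 in [rat]. *)
by have := phi_inj 0%R 1%R (etrans (phi1 _) (esym (phi1 _))).
Qed.
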